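(* Let $\mathfrak g$ be an affine Lie algebra and let $\Lambda\in P_+$ be a fixed dominant integral weight. Suppose $\eta\in\Lambda-Q$. Then there is some $s\in\mathbb Z$ such that $\eta+s\delta\in P(\Lambda)$.
   Context: $\mathfrak g$ is the affine Kac--Moody algebra over $\mathbb C$ with $(\ell+1)\times(\ell+1)$ affine Cartan matrix $A=[a_{ij}]_{0\le i,j\le\ell}$ (untwisted or twisted), with Cartan subalgebra $\mathfrak h$ (of dimension $\ell+2$), simple roots $\alpha_0,\dots,\alpha_\ell\in\mathfrak h^*$ and simple coroots $h_0,\dots,h_\ell\in\mathfrak h$, paired by $\langle h_i,\alpha_j\rangle=a_{ij}$. The null root is $\delta=a_0\alpha_0+\dots+a_\ell\alpha_\ell$, where $(a_0,\dots,a_\ell)$ are the coprime positive integers with $\sum_j a_{ij}a_j=0$ for all $i$. The root lattice is $Q=\sum_{i=0}^\ell\mathbb Z\alpha_i$. The set of integral weights is $P=\{\eta\in\mathfrak h^*\mid\langle h_i,\eta\rangle\in\mathbb Z\text{ for }i=0,\dots,\ell\}$, and the set of dominant integral weights is $P_+=\{\eta\in P\mid\langle h_i,\eta\rangle\ge0\text{ for }i=0,\dots,\ell\}$. For $\Lambda\in P_+$, $L(\Lambda)$ is the irreducible integrable highest-weight module with highest weight $\Lambda$, and $P(\Lambda)$ is the set of weights labelling the non-zero weight spaces of $L(\Lambda)$.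
   Formalization: The formal theorem assumes in addition that ⟨h_i,Λ⟩ > 0 for some i (positive level); otherwise L(Λ) is one-dimensional, P(Λ)={Λ}, and the claim fails for η=Λ−α_1. *)

(* Defs.v *)
From HB Require Import structures.
From mathcomp Require Import all_boot all_order all_algebra.
From mathcomp Require Import reals complex.

Set Implicit Arguments.
Unset Strict Implicit.
Unset Printing Implicit Defensive.

Import Order.TTheory GRing.Theory Num.Theory.

Local Open Scope ring_scope.

(** * Affine Cartan matrices *)

Definition generalized_cartan n (A : 'M[int]_n) : Prop :=
  [/\ forall i, A i i = 2,
      forall i j, i != j -> A i j <= 0
    & forall i j, A i j = 0 -> A j i = 0].

Definition indecomposable n (A : 'M[int]_n) : Prop :=
  forall S : {set 'I_n}, S != set0 -> S != [set: 'I_n] ->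
    exists i j, [/\ i \in S, j \notin S & (A i j != 0) || (A j i != 0)].

(* The last three fields are condition (Aff) in Kac's trichotomy
   finite / affine / indefinite (Infinite dimensional Lie algebras, Thm 4.3);
   together with the first two they cover exactly the untwisted and twisted
   affine Cartan matrices. *)
Record affine_cartan (R : realFieldType) n (A : 'M[int]_n) : Prop :=
  AffineCartan {
    affine_gcm : generalized_cartan A;
    affine_indecomposable : indecomposable A;
    affine_corank1 : (\rank (map_mx intr A : 'M[R]_n)).+1 = n;
    affine_null_vector : exists u : 'cV[R]_n,
      (forall i, 0 < u i 0) /\ map_mx intr A *m u = 0;
    affine_nonneg : forall v : 'cV[R]_n,
      (forall i, 0 <= (map_mx intr A *m v) i 0) -> map_mx intr A *m v = 0
  }.

(* The labels a_0, ..., a_l: they are uniquely determined by an affine A. *)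
Definition null_labels n (A : 'M[int]_n) (a : 'I_n -> nat) : Prop :=
  [/\ forall j, (0 < a j)%N,
      \big[gcdn/0%N]_j a j = 1%N
    & forall i, \sum_j A i j * (a j)%:Z = 0].

(** * Lie algebras and their modules *)

HB.mixin Record Lmodule_isLieAlgebra (K : fieldType) L
    of GRing.Lmodule K L := {
  lie : L -> L -> L;
  lie_linear_l : forall y, linear (lie^~ y);
  lie_linear_r : forall x, linear (lie x);
  lie_alternating : forall x, lie x x = 0;
  lie_jacobi : forall x y z,
    lie x (lie y z) + lie y (lie z x) + lie z (lie x y) = 0
}.

#[short(type="lieAlgType")]
HB.structure Definition LieAlgebra (K : fieldType) :=
  { L of GRing.Lmodule K L & Lmodule_isLieAlgebra K L }.

Definition is_subspace (K : fieldType) (V : lmodType K) (S : V -> Prop) : Prop :=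
  S 0 /\ forall (a : K) u v, S u -> S v -> S (a *: u + v).

Definition lie_subalgebra (K : fieldType) (g : lieAlgType K) (S : g -> Prop) :=
  is_subspace S /\ forall x y, S x -> S y -> S (lie x y).

Definition lie_ideal (K : fieldType) (g : lieAlgType K) (S : g -> Prop) :=
  is_subspace S /\ forall x y, S y -> S (lie x y).

Record lie_module (K : fieldType) (g : lieAlgType K) (V : lmodType K) :=
  LieModule {
    lie_act :> g -> V -> V;
    lie_act_linear_l : forall v, linear (lie_act^~ v);
    lie_act_linear_r : forall x, linear (lie_act x);
    lie_act_bracket : forall x y v,
      lie_act (lie x y) v = lie_act x (lie_act y v) - lie_act y (lie_act x v)
  }.

Section Modules.
Variables (K : fieldType) (g : lieAlgType K) (V : lmodType K).
Variable act : lie_module g V.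

Definition submodule (S : V -> Prop) : Prop :=
  is_subspace S /\ forall x v, S v -> S (act x v).

Definition irreducible_module : Prop :=
  (exists v : V, v != 0) /\
  forall S, submodule S -> (exists2 v, S v & v != 0) -> forall v, S v.

End Modules.

(** * Kac-Moody algebras *)

(* The elements of the dual of the finite-dimensional space H are
   linear forms 'Hom(H, K^o). *)

(* [kac_moody A H g] says how g is the Kac-Moody algebra of A with Cartan
   subalgebra H: (H, roots, coroots) is a realization of A; g is a quotient of
   the Lie algebra with generators H, e_i, f_i and relations [km_hh]-[km_ef]
   (this is [km_generated]), in which H embeds; and it is the quotient by the
   largest ideal meeting H trivially (this is [km_no_ideal]).  For affine A we
   have \rank A = l and n = l + 1, so that [km_dim] reads dim H = l + 2. *)
Record kac_moody (K : fieldType) n (A : 'M[int]_n)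
    (H : vectType K) (g : lieAlgType K) := KacMoody {
  km_root : 'I_n -> 'Hom(H, K^o);
  km_coroot : 'I_n -> H;
  km_cartan : {linear H -> g};
  km_e : 'I_n -> g;
  km_f : 'I_n -> g;
  km_dim : (\dim {:H} + \rank (map_mx intr A : 'M[K]_n) = n.*2)%N;
  km_root_free : free [tuple km_root i | i < n];
  km_coroot_free : free [tuple km_coroot i | i < n];
  km_pairing : forall i j, km_root j (km_coroot i) = (A i j)%:~R;
  km_cartan_inj : injective km_cartan;
  km_hh : forall h h', lie (km_cartan h) (km_cartan h') = 0;
  km_he : forall h i, lie (km_cartan h) (km_e i) = (km_root i h : K) *: km_e i;
  km_hf : forall h i,
    lie (km_cartan h) (km_f i) = - (km_root i h : K) *: km_f i;
  km_ef : forall i j,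
    lie (km_e i) (km_f j) = if i == j then km_cartan (km_coroot i) else 0;
  km_generated : forall S : g -> Prop, lie_subalgebra S ->
    (forall h, S (km_cartan h)) -> (forall i, S (km_e i)) ->
    (forall i, S (km_f i)) -> forall x, S x;
  km_no_ideal : forall S : g -> Prop, lie_ideal S ->
    (forall h, S (km_cartan h) -> h = 0) -> forall x, S x -> x = 0
}.

Section Weights.
Variables (K : numFieldType) (n : nat) (A : 'M[int]_n).
Variables (H : vectType K) (g : lieAlgType K) (G : kac_moody A H g).

Definition null_root (a : 'I_n -> nat) : 'Hom(H, K^o) :=
  \sum_j km_root G j *+ a j.

Definition root_lattice (beta : 'Hom(H, K^o)) : Prop :=
  exists c : 'I_n -> int, beta = \sum_i km_root G i *~ c i.

Definition integral_weight (eta : 'Hom(H, K^o)) : Prop :=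
  forall i, exists z : int, eta (km_coroot G i) = z%:~R.

Definition dominant_integral (eta : 'Hom(H, K^o)) : Prop :=
  integral_weight eta /\ forall i, 0 <= (eta (km_coroot G i) : K).

(* For dominant integral eta this says that the level, a combination of the
   <h_i, eta> with positive coefficients, is positive. *)
Definition positive_level (eta : 'Hom(H, K^o)) : Prop :=
  exists i, 0 < (eta (km_coroot G i) : K).

Variables (V : lmodType K) (act : lie_module g V).

Definition weight_vector (mu : 'Hom(H, K^o)) (v : V) : Prop :=
  forall h, act (km_cartan G h) v = (mu h : K) *: v.

Definition is_weight (mu : 'Hom(H, K^o)) : Prop :=
  exists2 v, weight_vector mu v & v != 0.

Definition highest_weight_module (Lambda : 'Hom(H, K^o)) : Prop :=
  exists v, [/\ v != 0,
    weight_vector Lambda v,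
    forall i, act (km_e G i) v = 0
  & forall S, submodule act S -> S v -> forall w, S w].

Definition integrable_module : Prop :=
  [/\ forall v, exists2 s : seq V, v = \sum_(w <- s) w &
        forall w, w \in s -> exists mu, weight_vector mu w,
      forall i v, exists m, iter m (act (km_e G i)) v = 0
    & forall i v, exists m, iter m (act (km_f G i)) v = 0].

(* V is a copy of L(Lambda). *)
Record is_L (Lambda : 'Hom(H, K^o)) : Prop := IsL {
  L_irreducible : irreducible_module act;
  L_highest_weight : highest_weight_module Lambda;
  L_integrable : integrable_module
}.

End Weights.

(* Main.v *)
Require Import Defs.
From HB Require Import structures.
From mathcomp Require Import all_boot all_order all_algebra.
From mathcomp Require Import reals complex.
From mathcomp Require Import ring lra zify.

Set Implicit Arguments.
Unset Strict Implicit.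
Unset Printing Implicit Defensive.

Import Order.TTheory GRing.Theory Num.Theory.

Local Open Scope ring_scope.

(* Weights of an integrable module are stable under the simple reflections, and
   [mu - alpha_i] is a weight whenever [mu] is one with [<h_i, mu> > 0] (sl2
   theory). Every element of [Lambda - Q] of positive level is conjugate under
   simple reflections to a dominant one: the reflections preserve the invariant
   norm, which bounds the height of [Lambda - mu] from below along an orbit.
   Since [delta] is fixed by the reflections, a shift by [delta] makes the
   dominant element [Lambda - gamma] satisfy [gamma >= 0]. Then it is a weight:
   climb from [Lambda] through weights [Lambda - beta] with [beta <= gamma];
   if no step is possible, [w = gamma - beta] satisfies [A w <= 0], hence
   [A w = 0], so [w] has full support and [Lambda - beta] has level [<= 0],
   a contradiction. *)

(** * Affine Cartan matrices *)

(** If [A i j] vanishes, so does [A j i]; hence a proper nonempty [T] would have no edge leaving it.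
    Applied below to supports of vectors. *)
Lemma indecomposable_full (n : nat) (A : 'M[int]_n) (T : {set 'I_n}) :
  generalized_cartan A -> indecomposable A -> T != set0 ->
  (forall i j, i \notin T -> j \in T -> A i j = 0) -> T = [set: 'I_n].
Proof.
move=> [_ _ Asym] indA T0 AT; apply/eqP/negPn/negP => TT.
have [i [j [iT jT]]] := indA T T0 TT.
have A0 := AT j i jT iT.
by rewrite A0 (Asym _ _ A0) eqxx.
Qed.

Section AffineMatrix.
Variables (R : realFieldType) (n : nat) (A : 'M[int]_n).
Hypothesis gcmA : generalized_cartan A.
Let M : 'M[R]_n := map_mx intr A.

Let M_diag i : M i i = 2.
Proof. by rewrite mxE; case: gcmA => -> _ _. Qed.

Let M_offdiag i j : i != j -> M i j <= 0.
Proof. by move=> ij; rewrite mxE lerz0; case: gcmA => _ /(_ i j ij). Qed.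

(* Taking absolute values of a left null vector keeps it in the kernel, as [A] is
   a Z-matrix with a positive right null vector. *)
Lemma left_null_vector (u : 'cV[R]_n) :
  indecomposable A -> (\rank M).+1 = n ->
  (forall i, 0 < u i 0) -> M *m u = 0 ->
  exists v : 'rV[R]_n, (forall i, 0 < v 0 i) /\ v *m M = 0.
Proof.
move=> indA rkM u0 Mu.
have /rowV0Pn [w wker w0] : kermx M != 0.
  by rewrite -mxrank_eq0 mxrank_ker -[X in (X - _)%N]rkM subSnn.
have {wker} wM : w *m M = 0 by apply/sub_kermxP.
pose v : 'rV[R]_n := \row_i `|w 0 i|.
have vM_le j : (v *m M) 0 j <= 0.
  have /rowP/(_ j) := wM; rewrite !mxE (bigD1 j) //= M_diag => /eqP.
  rewrite addr_eq0 => /eqP wj.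
  rewrite (bigD1 j) //= M_diag mxE.
  have -> : `|w 0 j| * 2 = `|\sum_(i < n | i != j) w 0 i * M i j|.
    by rewrite -[RHS]normrN -wj normrM [`|2|]ger0_norm // ler0n.
  rewrite -lerBrDr sub0r; apply: le_trans (ler_norm_sum _ _ _) _.
  rewrite -sumrN; apply: ler_sum => i ij.
  by rewrite [v 0 i]mxE normrM (ler0_norm (M_offdiag ij)) mulrN.
(* The entries of [v *m M] are nonpositive, and their combination with the positive coefficients [u]
   vanishes. *)
have vM : v *m M = 0.
  have /matrixP/(_ 0 0) : (v *m M) *m u = 0 by rewrite -mulmxA Mu mulmx0.
  rewrite [in LHS]mxE [RHS]mxE => s0.
  have /psumr_eq0P h : forall j, true -> 0 <= - ((v *m M) 0 j * u j 0).
    by move=> j _; rewrite oppr_ge0 mulr_le0_ge0 // ltW.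
  apply/rowP => j; rewrite [RHS]mxE; apply/eqP.
  have := h _ j erefl; rewrite sumrN s0 oppr0 => /(_ erefl)/eqP.
  by rewrite oppr_eq0 mulf_eq0 (gt_eqF (u0 j)) orbF.
exists v; split=> //.
(* Where [w] vanishes, the corresponding column of [v *m M = 0] is a sum of terms of one sign, so
   [A] has no entry linking it to the support. *)
suff T : [set i | w 0 i != 0] = [set: 'I_n].
  by move=> i; move/setP/(_ i): T; rewrite !inE mxE normr_gt0.
apply: (indecomposable_full gcmA indA).
  apply: contra_neq w0 => /setP T; apply/rowP => i; rewrite mxE.
  by move: (T i); rewrite !inE => /negbT/negPn/eqP.
move=> j i; rewrite !inE => /negPn/eqP wj wi.
have wij : w 0 i != w 0 j by rewrite wj.
have [_ _ Asym] := gcmA; apply: Asym.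
have /rowP/(_ j) := vM; rewrite !mxE => s0.
have /psumr_eq0P h : forall k, true -> 0 <= - (v 0 k * M k j).
  move=> k _; rewrite mxE; have [->|kj] := eqVneq k j.
    by rewrite wj normr0 mul0r oppr0.
  by rewrite oppr_ge0 mulr_ge0_le0 // M_offdiag.
have := h _ i erefl; rewrite sumrN s0 oppr0 => /(_ erefl)/eqP.
by rewrite !mxE oppr_eq0 mulf_eq0 normr_eq0 (negPf wi) intr_eq0 => /eqP.
Qed.

(** * Symmetrization by the null vectors *)

Section Symmetrization.
Variables (u : 'cV[R]_n) (v : 'rV[R]_n).
Hypotheses (u_gt0 : forall i, 0 < u i 0) (v_gt0 : forall i, 0 < v 0 i).
Hypotheses (Mu : M *m u = 0) (vM : v *m M = 0).

(** Scaling by both null vectors makes all row and column sums vanish. Symmetry of this matrix means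
    that the ratios [v i / u i] symmetrize [A]. *)
Definition null_scaling i j := v 0 i * M i j * u j 0.
Local Notation b := null_scaling.

Lemma null_scaling_row i : \sum_j b i j = 0.
Proof.
have /colP/(_ i) := Mu; rewrite !mxE => s.
by under eq_bigr => j _ do rewrite /b -mulrA; rewrite -mulr_sumr s mulr0.
Qed.

Lemma null_scaling_col j : \sum_i b i j = 0.
Proof.
have /rowP/(_ j) := vM; rewrite !mxE => s.
by rewrite -mulr_suml s mul0r.
Qed.

Lemma null_scaling_le0 i j : i != j -> b i j <= 0.
Proof.
move=> ij; rewrite /b mulr_le0_ge0 ?(ltW (u_gt0 _)) //.
by rewrite mulr_ge0_le0 ?M_offdiag // ltW.
Qed.

(* The entries of [A] are integers, so [A i j * A j i >= 1] on each edge. *)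
Lemma null_scaling_mul i j : i != j -> b i j != 0 ->
  v 0 i * u i 0 * (v 0 j * u j 0) <= b i j * b j i.
Proof.
move=> ij bij.
have Aij : A i j != 0.
  by apply: contra_neq bij => A0; rewrite /b mxE A0 mulr0 mul0r.
have [_ Ale Asym] := gcmA.
have Aji : A j i != 0 by apply: contra_neq Aij => /Asym.
have ij' : j != i by rewrite eq_sym.
have m1 : 1 <= M i j * M j i.
  rewrite !mxE -intrM ler1z.
  by have := Ale _ _ ij; have := Ale _ _ ij'; nia.
have -> : b i j * b j i = v 0 i * u i 0 * (v 0 j * u j 0) * (M i j * M j i).
  by rewrite /b; ring.
by rewrite ler_peMr // !mulr_ge0 // ltW.
Qed.

(* If [b] were not symmetric, choose [i] with [v_i u_i] minimal among the
   vertices met by the antisymmetric part. Zero divergence gives an outgoing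
   edge to some [j] and an incoming edge from some [k != j], and AM-GM on these
   two edges makes the off-diagonal part of row and column [i] too large. *)
Lemma null_scaling_sym i j : b i j = b j i.
Proof.
pose asym i := [exists j, b i j != b j i].
suff : ~~ asym i by rewrite negb_exists => /forallP/(_ j)/negPn/eqP.
apply/negP => asym_i.
pose w k := v 0 k * u k 0.
have w0 k : 0 < w k by rewrite mulr_gt0.
case: (arg_minP w asym_i) => k /existsP[x bkx] wmin.
have flow : \sum_j (b k j - b j k) = 0.
  by rewrite sumrB null_scaling_row null_scaling_col subrr.
have asymP p q : b p q != b q p -> asym q.
  by move=> e; apply/existsP; exists p; rewrite eq_sym.
have [y ylt] : exists y, b k y < b y k.
  apply/existsP; apply: contraLR bkx; rewrite negb_exists => /forallP h.
  have /psumr_eq0P g : forall y, true -> 0 <= b k y - b y k.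
    by move=> y _; rewrite subr_ge0 leNgt.
  by apply/negPn/eqP/subr0_eq; apply: g.
have [z zlt] : exists z, b z k < b k z.
  apply/existsP; apply: contraLR bkx; rewrite negb_exists => /forallP h.
  have /psumr_eq0P g : forall y, true -> 0 <= b y k - b k y.
    by move=> y' _; rewrite subr_ge0 leNgt.
  apply/negPn/eqP/esym/subr0_eq; apply: g => //.
  by rewrite sumrB null_scaling_row null_scaling_col subrr.
(* By minimality [b k p * b p k >= w k * w p >= w k ^+ 2]; AM-GM is strict because the two entries
   differ. *)
have edge p : b k p != b p k -> - (b k p + b p k) > 2 * w k.
  move=> ne.
  have kp : k != p by apply: contra_neq ne => ->.
  have pk : p != k by rewrite eq_sym.
  have le1 := null_scaling_le0 kp; have le2 := null_scaling_le0 pk.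
  have wkp : w k <= w p by apply: wmin; apply: asymP ne.
  have mul : w k * w p <= b k p * b p k.
    have [e|] := eqVneq (b k p) 0; last exact: null_scaling_mul.
    have e' : b p k != 0 by rewrite -e eq_sym.
    by rewrite mulrC [leRHS]mulrC; apply: null_scaling_mul.
  have sq : 0 < (b k p - b p k) ^+ 2 by rewrite exprn_even_gt0 ?subr_eq0.
  have := w0 k; have := w0 p; rewrite ltNge => wp wk; apply/negP => h.
  nra.
have zy : z != y by apply: contraTneq zlt => ->; rewrite -leNgt ltW.
have yk : y != k by apply: contraTneq ylt => ->; rewrite ltxx.
have zk : z != k by apply: contraTneq zlt => ->; rewrite ltxx.
have := edge y; rewrite lt_eqF // => /(_ isT) ey.
have := edge z; rewrite gt_eqF // => /(_ isT) ez.
have tot : \sum_j (b k j + b j k) = 0.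
  by rewrite big_split /= null_scaling_row null_scaling_col addr0.
move: tot; rewrite (bigD1 k) //= (bigD1 y) //= (bigD1 z) /= ?zk ?zy //.
have : \sum_(i0 < n | (i0 != k) && (i0 != y) && (i0 != z)) (b k i0 + b i0 k) <= 0.
  apply: sumr_le0 => p /andP[/andP[pk _] _].
  by rewrite -oppr_ge0 opprD addr_ge0 // oppr_ge0 null_scaling_le0 // eq_sym.
(* The diagonal contributes [4 * w k] to the zero total, the two edges less than [- 4 * w k]. *)
have -> : b k k = 2 * w k by rewrite /b M_diag /w; ring.
lra.
Qed.

(** As for a graph Laplacian, the vanishing sums turn the form into minus half the sum of
    [b i j * (x i - x j) ^+ 2], where off-diagonal [b i j] are nonpositive. *)
Lemma null_scaling_psd (x : 'I_n -> R) : 0 <= \sum_i \sum_j b i j * x i * x j.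
Proof.
have e : \sum_i \sum_j b i j * (x i - x j) ^+ 2 =
    - 2 * \sum_i \sum_j b i j * x i * x j.
  have e1 : \sum_i \sum_j b i j * x i ^+ 2 = 0.
    by apply: big1 => i _; rewrite -mulr_suml null_scaling_row mul0r.
  have e2 : \sum_i \sum_j b i j * x j ^+ 2 = 0.
    rewrite exchange_big; apply: big1 => j _.
    by rewrite -mulr_suml null_scaling_col mul0r.
  transitivity (\sum_i \sum_j b i j * x i ^+ 2 +
    (\sum_i \sum_j b i j * x j ^+ 2 - 2 * \sum_i \sum_j b i j * x i * x j)).
    rewrite mulr_sumr -sumrB -big_split /=; apply: eq_bigr => i _.
    rewrite mulr_sumr -sumrB -big_split /=; apply: eq_bigr => j _.
    by ring.
  by rewrite e1 e2 !add0r mulNr.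
suff : \sum_i \sum_j b i j * (x i - x j) ^+ 2 <= 0 by rewrite e; lra.
apply: sumr_le0 => i _; apply: sumr_le0 => j _.
have [->|ij] := eqVneq i j; first by rewrite subrr expr0n mulr0.
by rewrite mulr_le0_ge0 ?sqr_ge0 // null_scaling_le0.
Qed.

(** Dimension count: the image of [M] lies in the kernel of [v], and both have dimension [n - 1]. *)
Lemma image_of_left_null (r : 'cV[R]_n) :
  (\rank M).+1 = n -> v *m r = 0 -> exists g : 'cV[R]_n, M *m g = r.
Proof.
move=> rkM vr.
have MT : (M^T <= kermx v^T)%MS.
  by apply/sub_kermxP; rewrite -trmx_mul vM trmx0.
have rv : \rank v = 1%N.
  have n0 : (0 < n)%N by rewrite -rkM.
  apply/eqP; rewrite eqn_leq rank_leq_row lt0n mxrank_eq0.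
  by apply: contraTneq (v_gt0 (Ordinal n0)) => ->; rewrite mxE ltxx.
have := mxrank_leqif_sup MT => -[_].
rewrite mxrank_ker !mxrank_tr rv -[X in (X - 1)%N]rkM subn1 eqxx => /esym sub.
have /submxP[g gr] : (r^T <= M^T)%MS.
  by apply: submx_trans sub; apply/sub_kermxP; rewrite -trmx_mul vr trmx0.
by exists g^T; rewrite -[M]trmxK -trmx_mul -gr trmxK.
Qed.

End Symmetrization.
End AffineMatrix.

(** * Saturated subsets of the root lattice *)

Section Saturated.
Variables (R : archiRealFieldType) (n : nat) (A : 'M[int]_n).
Hypotheses (gcmA : generalized_cartan A) (indA : indecomposable A).
Local Notation M := (map_mx intr A : 'M[R]_n).
Hypothesis rkM : (\rank M).+1 = n.
Variable a : 'cV[int]_n.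
Hypotheses (a_gt0 : forall i, 0 < a i 0) (Aa : A *m a = 0).
Variable L : 'cV[int]_n.
Hypotheses (L_ge0 : forall i, 0 <= L i 0) (L_gt0 : exists i, 0 < L i 0).

(* The pairings of [Lambda - \sum_i c_i alpha_i] with the simple coroots, where
   [L] collects those of [Lambda]. *)
Definition labels (c : 'cV[int]_n) : 'cV[int]_n := L - A *m c.

Lemma labelsE c i : labels c i 0 = L i 0 - (A *m c) i 0.
Proof. by rewrite !mxE. Qed.

Local Notation e := (fun i => delta_mx i 0 : 'cV[int]_n).

Lemma sum_delta i : \sum_j e i j 0 = 1.
Proof.
rewrite (bigD1 i) //= mxE !eqxx big1 ?addr0 // => j ji.
by rewrite mxE (negPf ji).
Qed.

Lemma null_vector_gt0 i : 0 < (map_mx intr a : 'cV[R]_n) i 0.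
Proof. by rewrite mxE ltr0z. Qed.

Lemma null_vectorE : M *m map_mx intr a = 0.
Proof. by rewrite -map_mxM Aa map_mx0. Qed.

Section LeftNull.
Variable v : 'rV[R]_n.
Hypotheses (v_gt0 : forall i, 0 < v 0 i) (vM : v *m M = 0).

(** The level is constant on the coset of the root lattice because [v] kills [A]. *)
Lemma level_labels c :
  (v *m map_mx intr (labels c)) 0 0 = \sum_i v 0 i * (L i 0)%:~R.
Proof.
rewrite /labels map_mxB map_mxM mulmxBr mulmxA vM mul0mx subr0 mxE.
by apply: eq_bigr => i _; rewrite mxE.
Qed.

Lemma level_gt0 : 0 < \sum_i v 0 i * (L i 0)%:~R.
Proof.
have [i Li] := L_gt0; rewrite (bigD1 i) //=.
rewrite ltr_wpDr ?mulr_gt0 ?ltr0z //.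
by apply: sumr_ge0 => j _; rewrite mulr_ge0 ?ler0z // ltW.
Qed.

Lemma climb_step (b c : 'cV[int]_n) : (forall i, b i 0 <= c i 0) -> b != c ->
  (forall i, 0 <= labels c i 0) -> exists i, b i 0 < c i 0 /\ 0 < labels b i 0.
Proof.
move=> bc bNc cdom.
have [/existsP[i /andP[]]|] :=
  boolP [exists i, (b i 0 < c i 0) && (0 < labels b i 0)]; first by exists i.
rewrite negb_exists => /forallP noi; exfalso.
have {}noi i : b i 0 < c i 0 -> labels b i 0 <= 0.
  by move=> lt; have := noi i; rewrite lt /= -leNgt.
pose w := c - b.
have wE i : w i 0 = c i 0 - b i 0 by rewrite !mxE.
have w0 i : 0 <= w i 0 by rewrite wE subr_ge0.
have offdiag i j : w i 0 = 0 -> A i j * w j 0 <= 0.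
  have [->|ij] := eqVneq i j; first by move->; rewrite mulr0.
  by move=> _; rewrite mulr_le0_ge0 //; case: gcmA => _ + _; apply.
(* On the support of [w], [labels b <= 0 <= labels c]; off it only off-diagonal terms remain. *)
have Aw_le i : (A *m w) i 0 <= 0.
  have [wi|wi] := eqVneq (w i 0) 0.
    by rewrite mxE; apply: sumr_le0 => j _; apply: offdiag.
  have lt : b i 0 < c i 0 by rewrite lt_neqAle bc andbT eq_sym -subr_eq0 -wE.
  have := noi i lt; have := cdom i; rewrite !labelsE.
  rewrite /w mulmxBr [(_ - _ : 'cV_n) _ _]mxE [(- _ : 'cV_n) _ _]mxE.
  by rewrite !(subr_ge0, subr_le0) => h1 h2; apply: le_trans h1 h2.
have Aw i : (A *m w) i 0 = 0.
  have s0 : \sum_i - (v 0 i * ((A *m w) i 0)%:~R) = 0.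
    have /matrixP/(_ 0 0) : v *m M *m map_mx intr w = 0 by rewrite vM mul0mx.
    rewrite -mulmxA -map_mxM [in LHS]mxE [RHS]mxE => s0.
    apply/eqP; rewrite sumrN oppr_eq0 -[X in _ == X]s0.
    by apply/eqP/eq_bigr => j _; rewrite [map_mx _ _ _ _]mxE.
  have /psumr_eq0P h :
      forall k, true -> 0 <= - (v 0 k * ((A *m w) k 0)%:~R).
    move=> k _; rewrite oppr_ge0 mulr_ge0_le0 ?lerz0 //; exact: ltW.
  have /eqP := h s0 i erefl.
  by rewrite oppr_eq0 mulf_eq0 gt_eqF //= intr_eq0 => /eqP.
have T : [set i | 0 < w i 0] = [set: 'I_n].
  apply: (indecomposable_full gcmA indA).
    apply: contra_neq bNc => /setP T; apply/colP => i.
    apply/eqP; rewrite eq_le bc -subr_le0 -wE leNgt.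
    by have := T i; rewrite !inE => ->.
  move=> i j; rewrite !inE -leNgt => wi wj.
  have {}wi : w i 0 = 0 by apply/eqP; rewrite eq_le wi w0.
  have /psumr_eq0P h : forall k, true -> 0 <= - (A i k * w k 0).
    by move=> k _; rewrite oppr_ge0 offdiag.
  have /eqP : - (A i j * w j 0) = 0.
    by apply: h => //; rewrite sumrN; have := Aw i; rewrite mxE => ->;
      rewrite oppr0.
  by rewrite oppr_eq0 mulf_eq0 (gt_eqF wj) orbF => /eqP.
suff : (v *m map_mx intr (labels b)) 0 0 <= 0.
  by rewrite level_labels leNgt level_gt0.
rewrite mxE; apply: sumr_le0 => i _.
rewrite mulr_ge0_le0 ?[map_mx _ _ _ _]mxE ?lerz0 ?noi //; first exact: ltW.
by have /setP/(_ i) := T; rewrite !inE wE subr_gt0.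
Qed.

Lemma climb (P : 'cV[int]_n -> Prop) : P 0 ->
  (forall c i, P c -> 0 < labels c i 0 -> P (c + e i)) ->
  forall c : 'cV_n, (forall i, 0 <= c i 0) ->
    (forall i, 0 <= labels c i 0) -> P c.
Proof.
move=> P0 Pstep c c0 cdom.
(* Induction on the height still missing, the coefficient sum of [c - b]. *)
suff h (N : nat) (b : 'cV[int]_n) :
    (forall i, b i 0 <= c i 0) -> P b -> \sum_i (c - b) i 0 <= N%:Z -> P c.
  apply: (h (absz (\sum_i (c - 0) i 0)%R) 0) => //;
    last by rewrite abszE ler_norm.
  by move=> i; rewrite mxE.
elim: N b => [|N IH] b bc Pb sum.
  suff -> : c = b by [].
  have /psumr_eq0P h : forall k, true -> 0 <= (c - b) k 0.
    by move=> k _; rewrite !mxE subr_ge0.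
  apply/colP => i; apply/eqP; rewrite -subr_eq0.
  have := h _ i erefl; rewrite !mxE => ->//.
  by apply/eqP; rewrite eq_le sum sumr_ge0 // => k _; rewrite !mxE subr_ge0.
have [<-//|bNc] := eqVneq b c.
have [i [bi Li]] := climb_step bc bNc cdom.
apply: (IH (b + e i)); last 2 first.
- exact: Pstep.
- have -> : \sum_j (c - (b + e i)) j 0 = \sum_j (c - b) j 0 - 1; last by lia.
  rewrite -(sum_delta i).
  by rewrite -sumrB; apply: eq_bigr => j _; rewrite !mxE; ring.
move=> j; rewrite !mxE eqxx andbT; have := bc j.
by have [->|_] := eqVneq j i; rewrite ?addr0 // lezD1.
Qed.

Local Notation "c %:r" := (map_mx intr c : 'cV[R]_n) (at level 2).

Let d i : R := v 0 i / (a i 0)%:~R.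
(* The invariant form on the root space: [d] symmetrizes [A]. *)
Let Q (x y : 'cV[R]_n) := \sum_i x i 0 * (d i * (M *m y) i 0).

Let d_gt0 i : 0 < d i.
Proof. by rewrite divr_gt0 // ltr0z. Qed.

Let QDl (x y z : 'cV[R]_n) : Q (x + y) z = Q x z + Q y z.
Proof.
by rewrite -big_split; apply: eq_bigr => i _; rewrite [(x + y) _ _]mxE mulrDl.
Qed.

Let QZl t (x z : 'cV[R]_n) : Q (t *: x) z = t * Q x z.
Proof.
rewrite mulr_sumr; apply: eq_bigr => i _.
by rewrite [(_ *: _ : 'cV_n) _ _]mxE !mulrA.
Qed.

Let Qdelta k y : Q (delta_mx k 0) y = d k * (M *m y) k 0.
Proof.
rewrite /Q (bigD1 k) //= [delta_mx _ _ _ _]mxE !eqxx mul1r big1 ?addr0 // => i ik.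
by rewrite [delta_mx _ _ _ _]mxE (negPf ik) mul0r.
Qed.

(** In the coordinates [x i / a i] the form has matrix [null_scaling], whose symmetry and
    semidefiniteness carry over. *)
Let QE x y : Q x y = \sum_i \sum_j
  null_scaling A (map_mx intr a) v i j *
    (x i 0 / (a i 0)%:~R) * (y j 0 / (a j 0)%:~R).
Proof.
apply: eq_bigr => i _; rewrite [(_ *m _) _ _]mxE !mulr_sumr.
apply: eq_bigr => j _.
rewrite /null_scaling /d [map_mx _ _ j 0]mxE.
by field; rewrite !intr_eq0 !gt_eqF.
Qed.

Let QC x y : Q x y = Q y x.
Proof.
rewrite !QE exchange_big /=; apply: eq_bigr => i _; apply: eq_bigr => j _.
rewrite (null_scaling_sym gcmA null_vector_gt0 v_gt0 null_vectorE vM).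
by ring.
Qed.

Let QDr (x y z : 'cV[R]_n) : Q z (x + y) = Q z x + Q z y.
Proof. by rewrite QC QDl !(QC z). Qed.

Let QZr t (x z : 'cV[R]_n) : Q z (t *: x) = t * Q z x.
Proof. by rewrite QC QZl (QC z). Qed.

Let Q_ge0 x : 0 <= Q x x.
Proof.
rewrite QE.
exact: (null_scaling_psd gcmA null_vector_gt0 v_gt0 null_vectorE vM).
Qed.

(* The witness is [F c = |beta|^2 - 2 (Lambda, beta)] for [beta = \sum_i c_i alpha_i], which is
   [|Lambda - beta|^2 - |Lambda|^2]. Completing the square, with [Lambda] replaced
   up to a multiple of the height by [gamma] in the span of the roots, bounds the
   height from below on each level set. *)
Lemma reflection_invariant : exists F : 'cV[int]_n -> R,
  (forall c i, F (c + labels c i 0 *: e i) = F c) /\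
  forall r, exists N : int, forall c, F c = r -> N <= \sum_i c i 0.
Proof.
(* Since [v i / d i = a i], this [t] makes [v] annihilate the vector with entries [L i - t / d i],
   which then lies in the image of [M]. *)
pose t := (\sum_i v 0 i * (L i 0)%:~R) / (\sum_i (a i 0)%:~R).
have sa : 0 < \sum_i (a i 0)%:~R :> R.
  have [i _] := L_gt0; rewrite (bigD1 i) //= ltr_wpDr ?ltr0z //.
  by apply: sumr_ge0 => j _; rewrite ler0z ltW.
have t0 : 0 < t by rewrite divr_gt0 // level_gt0.
have [|gam Mgam] :=
  image_of_left_null v_gt0 vM (r := L%:r - \col_i (t / d i)) rkM.
  apply/rowP => j; rewrite ord1 {j} [RHS]mxE mulmxBr !mxE.
  apply/eqP; rewrite subr_eq0; apply/eqP.
  transitivity (t * \sum_i (a i 0)%:~R).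
    by rewrite /t divfK ?gt_eqF //; apply: eq_bigr => i _; rewrite mxE.
  rewrite mulr_sumr; apply: eq_bigr => i _; rewrite mxE /d.
  by field; rewrite intr_eq0 !gt_eqF.
pose l (x : 'cV[R]_n) := \sum_i x i 0 * (d i * (L i 0)%:~R).
have lE x : l x = Q x gam + t * \sum_i x i 0.
  rewrite mulr_sumr -big_split /=; apply: eq_bigr => i _.
  by rewrite Mgam !mxE; field; rewrite gt_eqF.
exists (fun c => Q c%:r c%:r - 2 * l c%:r); split=> [c i|r].
  have -> : (c + labels c i 0 *: e i)%:r =
      c%:r + ((L i 0)%:~R - (M *m c%:r) i 0) *: delta_mx i 0.
    rewrite map_mxD map_mxZ map_delta_mx; congr (_ + _ *: _).
    by rewrite -map_mxM labelsE rmorphB [map_mx _ _ _ _]mxE.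
  set s := (L i 0)%:~R - _.
  have lD x k : l (x + s *: delta_mx k 0) = l x + s * (d k * (L k 0)%:~R).
    rewrite /l; under eq_bigr => j _ do
      rewrite ![(_ + _ : 'cV_n) _ _]mxE [(_ *: _ : 'cV_n) _ _]mxE mulrDl.
    rewrite big_split /=; congr (_ + _); rewrite (bigD1 k) //= big1 => [|j jk].
      by rewrite addr0 [delta_mx _ _ _ _]mxE !eqxx mulr1.
    by rewrite [delta_mx _ _ _ _]mxE (negPf jk) mulr0 mul0r.
  have Qdd : Q (delta_mx i 0) (delta_mx i 0) = 2 * d i.
    rewrite Qdelta mxE (bigD1 i) //= big1 => [|j ji].
      by rewrite !mxE !eqxx; case: gcmA => -> _ _; rewrite addr0 mulr1 mulrC.
    by rewrite [delta_mx _ _ _ _]mxE (negPf ji) mulr0.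
  rewrite lD !(QDl, QDr, QZl, QZr) Qdd (QC c%:r (delta_mx _ _)) Qdelta.
  by rewrite /s; ring.
(* The bound solves [Q (c - gam) (c - gam) >= 0] for the height [ht] of [c]: it reads
   [F c + 2 * t * ht + Q gam gam >= 0]. *)
exists (Num.floor (- (r + Q gam gam) / (2 * t))) => c Fc.
rewrite -(ler_int R); apply: le_trans (Num.Theory.ge_floor _) _.
have -> : (\sum_i c i 0)%:~R = \sum_i c%:r i 0 :> R.
  by rewrite rmorph_sum; apply: eq_bigr => i _; rewrite mxE.
have := Q_ge0 (c%:r - gam).
rewrite -scaleN1r !(QDl, QDr, QZl, QZr) (QC gam c%:r).
have t2 : 0 < 2 * t by rewrite pmulr_rgt0.
rewrite ler_pdivrMr // -Fc lE.
move=> h; rewrite -subr_ge0; apply: le_trans h _; rewrite le_eqVlt.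
by apply/orP; left; apply/eqP; ring.
Qed.

End LeftNull.

Lemma saturated_full (P : 'cV[int]_n -> Prop) : P 0 ->
  (forall c i, P c -> 0 < labels c i 0 -> P (c + e i)) ->
  (forall c i, P c -> P (c + labels c i 0 *: e i)) ->
  forall c, exists s : int, P (c + s *: a).
Proof.
move=> P0 Pstep Prefl.
have [v [v_gt0 vM]] :=
  left_null_vector gcmA indA rkM null_vector_gt0 null_vectorE.
have labels_null c s : labels (c + s *: a) = labels c.
  by rewrite /labels mulmxDr -scalemxAr Aa scaler0 addr0.
have [F [Finv Fbound]] := reflection_invariant v_gt0 vM.
move=> c0; have [N Nle] := Fbound (F c0).
have step c : F c = F c0 -> (exists s : int, P (c + s *: a)) \/
    exists c', [/\ F c' = F c0, \sum_i c' i 0 < \sum_i c i 0 &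
      forall s : int, P (c' + s *: a) -> P (c + s *: a)].
  move=> Fc; have [/forallP cdom|] := boolP [forall i, 0 <= labels c i 0].
    (* As every [a i >= 1], this shift makes all coefficients nonnegative without changing the
       labels. *)
    left; exists (\sum_i `|c i 0|).
    apply: (climb v_gt0 vM P0 Pstep) => i; last by rewrite labels_null.
    rewrite !mxE (bigD1 i) //=.
    have S0 : 0 <= \sum_(j < n | j != i) `|c j 0| by apply: sumr_ge0.
    have : `|c i 0| <= (`|c i 0| + \sum_(j < n | j != i) `|c j 0|) * a i 0.
      rewrite mulrDl ler_wpDr ?mulr_ge0 ?(ltW (a_gt0 i)) //.
      by rewrite ler_peMr // -gtz0_ge1.
    rewrite -lerBlDl sub0r => h; apply: le_trans h.
    by rewrite -normrN ler_norm.
  case/forallPn=> i; rewrite -ltNge => ci.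
  (* At a negative label the reflection lowers the coefficient sum; being an involution, it carries
     [P] back. *)
  right; exists (c + labels c i 0 *: e i); split; first by rewrite Finv.
    suff -> : \sum_j (c + labels c i 0 *: e i) j 0 =
        \sum_j c j 0 + labels c i 0 * \sum_j e i j 0.
      by rewrite sum_delta mulr1; lia.
    by rewrite mulr_sumr -big_split; apply: eq_bigr => j _; rewrite !mxE.
  move=> s /(Prefl _ i).
  suff -> : labels (c + labels c i 0 *: e i + s *: a) i 0 = - labels c i 0.
    by rewrite scaleNr addrAC addrK.
  have Ae : (A *m e i) i 0 = 2.
    rewrite mxE (bigD1 i) //= mxE !eqxx big1 => [|j ji].
      by rewrite addr0 mulr1; case: gcmA.
    by rewrite mxE (negPf ji) mulr0.
  rewrite labels_null [LHS]labelsE mulmxDr -scalemxAr.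
  rewrite [(_ + _ : 'cV_n) _ _]mxE [(_ *: _ : 'cV_n) _ _]mxE Ae labelsE.
  by ring.
(* Coefficient sums on the level set of [F] are at least [N], so the descent stops. *)
suff h (k : nat) c : F c = F c0 -> \sum_i c i 0 <= N + k%:Z ->
    exists s : int, P (c + s *: a).
  apply: (h (absz (\sum_i c0 i 0 - N)%R)) => //.
  by rewrite -lerBlDl abszE ler_norm.
elim: k c => [|k IH] c Fc ck; have [//|[c' [Fc' lt Pc']]] := step c Fc.
  by have := Nle c' Fc'; lia.
have [|s Ps] := IH c' Fc'; first by lia.
by exists s; apply: Pc'.
Qed.

End Saturated.

(** * Strings of weights *)

Section SL2.
Variables (K : numFieldType) (V : lmodType K) (e f h : V -> V).
Hypotheses (lin_e : linear e) (lin_f : linear f).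
Hypothesis efE : forall v, e (f v) = f (e v) + h v.
Hypothesis heE : forall v, h (e v) = e (h v) + 2 *: e v.
Hypothesis hfE : forall v, h (f v) = f (h v) - 2 *: f v.

Let linZ (p : V -> V) : linear p -> forall c v, p (c *: v) = c *: p v.
Proof. by move=> lin_p c v; exact: scalable_linear lin_p c v. Qed.

Let linD (p : V -> V) : linear p -> forall v w, p (v + w) = p v + p w.
Proof. by move=> lin_p v w; have := lin_p 1 v w; rewrite !scale1r. Qed.

Lemma sl2_h_iter_f (m : K) v k :
  h v = m *: v -> h (iter k f v) = (m - (2 * k)%:R) *: iter k f v.
Proof.
move=> hv; elim: k => [|k IH] /=; first by rewrite muln0 subr0.
by rewrite hfE IH (linZ lin_f) -scalerBl mulnS natrD; congr (_ *: _); ring.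
Qed.

(** Moving [e] past each [f] collects the [h]-eigenvalues [m, m - 2, ..., m - 2 * k], whose sum is
    [k.+1 * (m - k)]. *)
Lemma sl2_e_iter_f (m : K) v k : h v = m *: v ->
  e (iter k.+1 f v) = iter k.+1 f (e v) + (k.+1%:R * (m - k%:R)) *: iter k f v.
Proof.
move=> hv; elim: k => [|k IH].
  by rewrite /= efE hv mul1r subr0.
rewrite iterS efE IH (linD lin_f) (linZ lin_f) -!iterS (sl2_h_iter_f _ hv).
rewrite -addrA -scalerDl; congr (_ + _ *: _).
rewrite mulnS -(addn1 k.+1) -(addn1 k) !natrD; ring.
Qed.

(* If [f^m v = 0] then [f^(m+2) (e v) = 0], so [e v = 0] by induction on the
   nilpotency of [e], and [v] is a highest weight vector. *)
Lemma sl2_iter_f_inj N (m : nat) v : h v = m%:R *: v ->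
  iter N e v = 0 -> iter m f v = 0 -> v = 0.
Proof.
elim: N m v => [//|N IH] m v hv eN fm.
have f0 : f 0 = 0 by have := linZ lin_f 0 0; rewrite !scale0r.
have e0 : e 0 = 0 by have := linZ lin_e 0 0; rewrite !scale0r.
have ev : e v = 0.
  apply: (IH m.+2); last 1 first.
  - have := sl2_e_iter_f m hv.
    by rewrite /= fm subrr mulr0 scale0r addr0 f0 e0 => <-.
  - by rewrite heE hv (linZ lin_e) -scalerDl -natrD addn2.
  - by rewrite -iterSr.
(* For [j < m] the factor [j.+1 * (m - j)] is nonzero, so applying [e] to [f^(j+1) v = 0] gives
   [f^j v = 0]. *)
have down : forall j, (j <= m)%N -> iter j f v = 0 -> v = 0.
  elim=> [//|j IHj] jm fj; apply: IHj; first exact: ltnW.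
  have := sl2_e_iter_f j hv.
  have -> : iter j.+1 f (e v) = 0 by rewrite ev; elim: (j.+1) => //= ? ->.
  rewrite fj e0 add0r => /esym/eqP; rewrite scaler_eq0 mulf_eq0 pnatr_eq0 /=.
  by rewrite subr_eq0 eqr_nat gtn_eqF //= => /eqP.
exact: (down m).
Qed.

End SL2.

(** * Weights of integrable modules *)

Section Weights.
Variables (K : numFieldType) (n : nat) (A : 'M[int]_n).
Variables (H : vectType K) (g : lieAlgType K) (G : kac_moody A H g).
Variables (V : lmodType K) (act : lie_module g V).
Hypothesis intV : integrable_module G act.
Hypothesis A_diag : forall i, A i i = 2.

Lemma act_scale c x v : act (c *: x) v = c *: act x v.
Proof. exact: scalable_linear (lie_act_linear_l act v) c x. Qed.

Lemma act_scale_r x c v : act x (c *: v) = c *: act x v.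
Proof. exact: scalable_linear (lie_act_linear_r act x) c v. Qed.

Lemma act0 x : act x 0 = 0.
Proof. by have := act_scale_r x 0 0; rewrite !scale0r. Qed.

Lemma act_comm x y v : act x (act y v) = act y (act x v) + act (lie x y) v.
Proof. by rewrite lie_act_bracket addrC subrK. Qed.

Lemma lfun_mulrn (beta : 'Hom(H, K^o)) k h : (beta *+ k) h = beta h *+ k.
Proof.
elim: k => [|k IH]; first by rewrite !mulr0n zero_lfunE.
by rewrite !mulrS add_lfunE IH.
Qed.

Lemma weight_vector_e i mu k v : weight_vector G act mu v ->
  weight_vector G act (mu + km_root G i *+ k) (iter k (act (km_e G i)) v).
Proof.
move=> wv h; elim: k => [|k IH] /=; first by rewrite mulr0n addr0 wv.
rewrite act_comm IH act_scale_r km_he act_scale -scalerDl.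
by congr (_ *: _); rewrite !add_lfunE !lfun_mulrn mulrS; ring.
Qed.

Lemma weight_vector_f i mu k v : weight_vector G act mu v ->
  weight_vector G act (mu - km_root G i *+ k) (iter k (act (km_f G i)) v).
Proof.
move=> wv h; elim: k => [|k IH] /=; first by rewrite mulr0n subr0 wv.
rewrite act_comm IH act_scale_r km_hf act_scale -scalerDl.
by congr (_ *: _); rewrite !add_lfunE !opp_lfunE !lfun_mulrn mulrS; ring.
Qed.

(** If [f^k v] were zero, so would be [f^m v], against the injectivity of [f^m] on vectors of
    [h]-weight [m]. *)
Lemma is_weight_sub i mu (m k : nat) : is_weight G act mu ->
  mu (km_coroot G i) = m%:R -> (k <= m)%N ->
  is_weight G act (mu - km_root G i *+ k).
Proof.
move=> [v wv v0] mum km; exists (iter k (act (km_f G i)) v).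
  exact: weight_vector_f.
apply: contra_neq v0 => fk; have [_ /(_ i v)[N eN] _] := intV.
pose h := act (km_cartan G (km_coroot G i)).
apply: (@sl2_iter_f_inj _ _ (act (km_e G i)) (act (km_f G i)) h _ _ _ _ _ N m).
- exact: lie_act_linear_r.
- exact: lie_act_linear_r.
- by move=> w; rewrite act_comm km_ef eqxx.
- by move=> w; rewrite /h act_comm km_he act_scale km_pairing A_diag.
- move=> w; rewrite /h act_comm km_hf act_scale km_pairing A_diag.
  by rewrite scaleNr.
- by rewrite /h wv mum.
- exact: eN.
- rewrite -(subnK km) iterD fk.
  by elim: (m - k)%N => //= ? ->; rewrite act0.
Qed.

Lemma is_weight_add i mu (m k : nat) : is_weight G act mu ->
  mu (km_coroot G i) = - m%:R -> (k <= m)%N ->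
  is_weight G act (mu + km_root G i *+ k).
Proof.
move=> [v wv v0] mum km; exists (iter k (act (km_e G i)) v).
  exact: weight_vector_e.
apply: contra_neq v0 => fk; have [_ _ /(_ i v)[N eN]] := intV.
(* Exchanging [e] and [f] and negating [h] preserves the sl2 relations. *)
pose h w := - act (km_cartan G (km_coroot G i)) w.
apply: (@sl2_iter_f_inj _ _ (act (km_f G i)) (act (km_e G i)) h _ _ _ _ _ N m).
- exact: lie_act_linear_r.
- exact: lie_act_linear_r.
- by move=> w; rewrite /h [act (km_e G i) (act _ _)]act_comm km_ef eqxx addrK.
- move=> w; rewrite /h act_comm km_hf act_scale km_pairing A_diag.
  by rewrite -[- act _ w]scaleN1r act_scale_r scaleN1r opprD scaleNr opprK.
- move=> w; rewrite /h act_comm km_he act_scale km_pairing A_diag.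
  by rewrite -[- act _ w]scaleN1r act_scale_r scaleN1r opprD.
- by rewrite /h wv mum scaleNr opprK.
- exact: eN.
- rewrite -(subnK km) iterD fk.
  by elim: (m - k)%N => //= ? ->; rewrite act0.
Qed.

(** * Weights in the coset of [Lambda] modulo the root lattice *)

Section LatticeWeights.
Variables (Lambda : 'Hom(H, K^o)) (L : 'cV[int]_n).
Hypothesis LambdaL : forall i, Lambda (km_coroot G i) = (L i 0)%:~R.

Definition lattice_weight (c : 'cV[int]_n) : 'Hom(H, K^o) :=
  Lambda - \sum_j km_root G j *~ c j 0.

Lemma lattice_weightD c c' :
  lattice_weight (c + c') = lattice_weight c - \sum_j km_root G j *~ c' j 0.
Proof.
rewrite /lattice_weight -addrA -opprD -big_split /=; congr (_ - _).
by apply: eq_bigr => j _; rewrite mxE mulrzDr.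
Qed.

Lemma lattice_weightDe c i (t : int) :
  lattice_weight (c + t *: delta_mx i 0) = lattice_weight c - km_root G i *~ t.
Proof.
rewrite lattice_weightD (bigD1 i) //= big1 => [|j ji].
  by rewrite !mxE !eqxx mulr1 addr0.
by rewrite !mxE (negPf ji) mulr0.
Qed.

Lemma lattice_weight_coroot c i :
  lattice_weight c (km_coroot G i) = (labels A L c i 0)%:~R.
Proof.
rewrite labelsE rmorphB /= add_lfunE opp_lfunE sum_lfunE LambdaL mxE rmorph_sum.
congr (_ - _); apply: eq_bigr => j _ /=.
rewrite intrM -(km_pairing G); case: (c j 0) => k.
  by rewrite -pmulrn lfun_mulrn mulr_natr.
by rewrite NegzE !mulrNz -pmulrn opp_lfunE lfun_mulrn mulrN mulr_natr.
Qed.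

Lemma is_weight_climb c i : is_weight G act (lattice_weight c) ->
  0 < labels A L c i 0 -> is_weight G act (lattice_weight (c + delta_mx i 0)).
Proof.
move=> wc Lc; rewrite -[delta_mx i 0]scale1r lattice_weightDe.
apply: (@is_weight_sub i _ (absz (labels A L c i 0)) 1) => //; last by lia.
by rewrite lattice_weight_coroot pmulrn gtz0_abs.
Qed.

(** The reflection moves by the full label along the root string: down with [f] if the label is
    nonnegative, up with [e] if it is negative. *)
Lemma is_weight_reflect c i : is_weight G act (lattice_weight c) ->
  is_weight G act (lattice_weight (c + labels A L c i 0 *: delta_mx i 0)).
Proof.
move=> wc; rewrite lattice_weightDe.
have := lattice_weight_coroot c i; case: (labels A L c i 0) => k ck.
  exact: (is_weight_sub wc ck).
rewrite NegzE mulrNz opprK; apply: (is_weight_add wc) (leqnn _).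
by rewrite ck NegzE mulrNz.
Qed.

End LatticeWeights.
End Weights.

(* [positive_level] excludes Lambda = 0 and its translates by multiples of
   delta, for which L(Lambda) is one-dimensional and the claim fails. *)
Theorem proposition2p2 (R : realType) (l : nat) (A : 'M[int]_l.+1)
    (affA : affine_cartan R A)
    (a : 'I_l.+1 -> nat) (aP : null_labels A a)
    (H : vectType R[i]) (g : lieAlgType R[i]) (G : kac_moody A H g)
    (Lambda : 'Hom(H, R[i]^o))
    (Lambda_dom : dominant_integral G Lambda)
    (Lambda_lvl : positive_level G Lambda)
    (V : lmodType R[i]) (act : lie_module g V) (LV : is_L G act Lambda)
    (eta : 'Hom(H, R[i]^o)) (etaP : root_lattice G (Lambda - eta)) :
  exists s : int, is_weight G act (eta + null_root G a *~ s).
Proof.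
case: affA => gcmA indA rkA _ _; case: aP => a_gt0 _ Aa.
case: Lambda_dom => Lint Lpos; case: LV => _ [v0 [v0n0 wv0 _ _]] intV.
have Lex i : exists z : int, Lambda (km_coroot G i) == z%:~R.
  by have [z ->] := Lint i; exists z.
pose L : 'cV[int]_l.+1 := \col_i xchoose (Lex i).
have LE i : Lambda (km_coroot G i) = (L i 0)%:~R.
  by rewrite mxE; apply/eqP/(xchooseP (Lex i)).
have L_ge0 i : 0 <= L i 0 by have := Lpos i; rewrite LE ler0z.
have L_gt0 : exists i, 0 < L i 0.
  by have [k] := Lambda_lvl; rewrite LE ltr0z; exists k.
pose ac : 'cV[int]_l.+1 := \col_i (a i)%:Z.
have ac_gt0 i : 0 < ac i 0 by rewrite mxE; exact: a_gt0.
have Aac : A *m ac = 0.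
  apply/colP => i; rewrite !mxE -[RHS](Aa i).
  by apply: eq_bigr => j _; rewrite mxE.
have A_diag i : A i i = 2 by case: gcmA.
pose P c := is_weight G act (lattice_weight G Lambda c).
have P0 : P 0.
  exists v0 => //; rewrite /lattice_weight big1 ?subr0 // => j _.
  by rewrite mxE mulr0z.
have [c etac] := etaP.
have [s] := saturated_full gcmA indA rkA ac_gt0 Aac L_ge0 L_gt0 P0
  (is_weight_climb intV A_diag LE) (is_weight_reflect intV A_diag LE)
  (\col_i c i).
(* Coefficients are subtracted from [Lambda], so adding [s *: ac] to them lowers the weight by [s]
   times the null root. *)
rewrite /P lattice_weightD => w; exists (- s).
have etaE : eta = lattice_weight G Lambda (\col_i c i).
  rewrite /lattice_weight; under eq_bigr do rewrite mxE.
  by rewrite -etac subKr.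
have dE : \sum_j km_root G j *~ (s *: ac) j 0 = null_root G a *~ s.
  rewrite /null_root mulrz_suml; apply: eq_bigr => j _.
  by rewrite !mxE mulrC mulrzA.
by rewrite mulrNz -dE etaE.
Qed.
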